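(* Let $F$ be an integral binary quartic form with $\Delta(F)\neq 0$. Then the following are equivalent. (1) $\mathcal{Q}_F(x)$ is reducible (over $\mathbb{Q}$). (2) $F_T=F$ for some $T\in \mathrm{GL}_2(\mathbb{Q})$ which is not a scalar multiple of $I_{2\times 2}$. (3) $F_{M_f}=F$ for an integral and primitive binary quadratic form $f$ with $\Delta(f)\neq 0$. Moreover, in the case that $\mathcal{Q}_F(x)$ is reducible: (a) if $\Delta(F)$ is not a square, then there is a unique such $f$ (i.e. a unique $f$ as in (3)) up to sign; (b) if $\Delta(F)$ is a square, then there are exactly three such $f$ up to sign, among which one is definite and two are indefinite.
   Context: A binary form is integral if its coefficients lie in $\mathbb{Z}$; an integral binary quadratic form is primitive if its coefficients are coprime. For a binary form $\xi(x,y)$ and $T=\begin{pmatrix} t_1&t_2\\t_3&t_4\end{pmatrix}\in\mathrm{GL}_2(\mathbb{R})$, put $\xi_T(x,y)=\det(T)^{-\deg\xi/2}\,\xi(t_1x+t_2y,\,t_3x+t_4y)$ (twisted action). For $f(x,y)=\alpha x^2+\beta xy+\gamma y^2$, put $\Delta(f)=\beta^2-4\alpha\gamma$ and $M_f=\begin{pmatrix}\beta&2\gamma\\-2\alpha&-\beta\end{pmatrix}$. For $F(x,y)=a_4x^4+a_3x^3y+a_2x^2y^2+a_1xy^3+a_0y^4$, put $I(F)=12a_4a_0-3a_3a_1+a_2^2$, $J(F)=72a_4a_2a_0+9a_3a_2a_1-27a_4a_1^2-27a_3^2a_0-2a_2^3$, $\Delta(F)=(4I(F)^3-J(F)^2)/27$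 (the discriminant of $F$), and let $\mathcal{Q}_F(x)=x^3-3I(F)x+J(F)$ be the cubic resolvent of $F$. *)

(* Defs.v *)
From mathcomp Require Import all_boot all_order all_algebra.
From mathcomp Require Export mpoly.

Set Implicit Arguments.
Unset Strict Implicit.
Unset Printing Implicit Defensive.

Import Order.TTheory GRing.Theory Num.Theory.
Local Open Scope ring_scope.

(* A binary form of degree d over R is a p : {mpoly R[2]} with
   p \is d.-homog, where x = 'X_0 and y = 'X_1. *)

Definition bcoef (R : nzRingType) (p : {mpoly R[2]}) (i j : nat) : R :=
  p@_[multinom of [:: i; j]].

Definition bval (R : comNzRingType) (p : {mpoly R[2]}) (x y : R) : R :=
  p.@[tnth [tuple x; y]].

Definition toQ (p : {mpoly int[2]}) : {mpoly rat[2]} :=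
  map_mpoly (intr : int -> rat) p.

(* The factor det(T)^(-deg/2) is only meaningful here for forms of even degree.
   For a nonzero form, (msize xi).-1 is its degree. *)
Definition twist (K : fieldType) (xi : {mpoly K[2]}) (T : 'M[K]_2) :
    {mpoly K[2]} :=
  \det T ^- (msize xi).-1./2
    *: (xi \mPo [tuple \sum_(j < 2) T i j *: 'X_j | i < 2]).

Section Quadratic.
Variables (R : comNzRingType) (f : {mpoly R[2]}).
Let al := bcoef f 2 0.
Let be := bcoef f 1 1.
Let ga := bcoef f 0 2.

Definition quad_disc : R := be ^+ 2 - 4 * al * ga.

Definition quad_mx : 'M[R]_2 :=
  \matrix_(i < 2, j < 2)
    (if i == 0 then (if j == 0 then be else 2 * ga)
     else (if j == 0 then - (2 * al) else - be)).

End Quadratic.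

Definition quad_primitive (f : {mpoly int[2]}) : bool :=
  gcdz (gcdz (bcoef f 2 0) (bcoef f 1 1)) (bcoef f 0 2) == 1.

(* Definiteness in terms of the integers represented.  For integral binary
   quadratic forms this agrees with definiteness over the reals. *)
Definition quad_definite (f : {mpoly int[2]}) : Prop :=
  (forall x y : int, (x, y) != (0, 0) -> 0 < bval f x y) \/
  (forall x y : int, (x, y) != (0, 0) -> bval f x y < 0).

Definition quad_indefinite (f : {mpoly int[2]}) : Prop :=
  (exists x y : int, 0 < bval f x y) /\ (exists x y : int, bval f x y < 0).

Section Quartic.
Variables (R : comNzRingType) (F : {mpoly R[2]}).
Let a4 := bcoef F 4 0.
Let a3 := bcoef F 3 1.
Let a2 := bcoef F 2 2.
Let a1 := bcoef F 1 3.
Let a0 := bcoef F 0 4.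

Definition quartic_I : R := 12 * a4 * a0 - 3 * a3 * a1 + a2 ^+ 2.

Definition quartic_J : R :=
  72 * a4 * a2 * a0 + 9 * a3 * a2 * a1 - 27 * a4 * a1 ^+ 2
  - 27 * a3 ^+ 2 * a0 - 2 * a2 ^+ 3.

End Quartic.

Definition quartic_disc (K : fieldType) (F : {mpoly K[2]}) : K :=
  (4 * quartic_I F ^+ 3 - quartic_J F ^+ 2) / 27.

Definition cubic_resolvent (R : comNzRingType) (F : {mpoly R[2]}) : {poly R} :=
  'X^3 - (3 * quartic_I F) *: 'X + (quartic_J F)%:P.

Definition fixing_form (F f : {mpoly int[2]}) : Prop :=
  [/\ f \is 2.-homog, quad_primitive f, quad_disc f != 0 &
      twist (toQ F) (quad_mx (toQ f)) = toQ F].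

Definition eq_up_to_sign (f g : {mpoly int[2]}) : Prop := f = g \/ f = - g.

(* Main.v *)
(* Sending a quadratic form f to its second transvectant with F is a
   self-adjoint endomorphism B_F of the three-dimensional space of quadratic
   forms equipped with the discriminant, and -8 Q_F(z) is its characteristic
   polynomial at -2 z.  A substitution T with F_T = F commutes with B_F up to
   the factor det T; its traceless part, seen as a quadratic form f, spans the
   forms with f o T = (det T) f, hence f is an eigenvector of B_F.  Conversely
   M_f acts as the half-turn about f, which commutes with B_F as soon as f is an
   eigenvector.  So the f with F_{M_f} = F are the eigenvectors of B_F, and
   Delta(F) <> 0 makes the eigenvalues simple and the eigenvectors
   non-isotropic.  Since the discriminant has signature (2, 1), exactly one of
   three orthogonal eigenvectors is definite. *)

Require Import Defs.
From mathcomp Require Import all_boot all_order all_algebra.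
From mathcomp Require Import ring lra zify.
From Stdlib Require Classical_Prop.
Set Implicit Arguments.
Unset Strict Implicit.
Unset Printing Implicit Defensive.
Import Order.TTheory GRing.Theory Num.Theory.
Local Open Scope ring_scope.

(** * Binary forms and their coefficients *)

Lemma mnm2E (i j : nat) :
  [multinom of [:: i; j]] = (U_(0%R) *+ i + U_(1%R) *+ j)%MM :> 'X_{1..2}.
Proof.
apply/mnmP=> k; rewrite mnmDE !mulmnE !mnm1E multinomE (tnth_nth 0%N) /=.
by case: k => [[|[|?]] ?] //=; rewrite ?mul1n ?mul0n ?addn0.
Qed.

Lemma bcoefX (R : nzRingType) (i j k l : nat) :
  bcoef ('X_0 ^+ i * 'X_1 ^+ j : {mpoly R[2]}) k l
  = ((i == k) && (j == l))%:R.
Proof.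
rewrite /bcoef !mpolyXn -mpolyXD mcoeffX -mnm2E; congr (_%:R); congr nat_of_bool.
apply/eqP/andP => [/mnmP e|[/eqP -> /eqP ->]] //.
by move: (e 0) (e 1); rewrite !multinomE !(tnth_nth 0%N) /= => -> ->.
Qed.

Lemma homog2_eq (R : nzRingType) (d : nat) (p q : {mpoly R[2]}) :
  p \is d.-homog -> q \is d.-homog ->
  (forall i j, (i + j = d)%N -> bcoef p i j = bcoef q i j) -> p = q.
Proof.
move=> hp hq e; apply/mpolyP=> m.
have [dm|dm] := eqVneq (mdeg m) d; last first.
  by rewrite (dhomog_nemf_coeff hp dm) (dhomog_nemf_coeff hq dm).
have -> : m = [multinom of [:: m 0; m 1]].
  apply/mnmP=> k; rewrite multinomE (tnth_nth 0%N) /=.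
  by case: k => [[|[|?]] ?] //=; congr (m _); apply: val_inj.
apply: e; rewrite -dm mdegE !big_ord_recl big_ord0 addn0.
by congr (_ + m _)%N; apply: val_inj.
Qed.

(** The trivial powers are kept so that every monomial has the shape to which [bcoefX] and [homogCX]
    apply. *)
Definition quad_form (R : comNzRingType) (a b c : R) : {mpoly R[2]} :=
  a%:MP * ('X_0 ^+ 2 * 'X_1 ^+ 0) + b%:MP * ('X_0 ^+ 1 * 'X_1 ^+ 1)
  + c%:MP * ('X_0 ^+ 0 * 'X_1 ^+ 2).

Definition quartic_form (R : comNzRingType) (a b c d e : R) : {mpoly R[2]} :=
  a%:MP * ('X_0 ^+ 4 * 'X_1 ^+ 0) + b%:MP * ('X_0 ^+ 3 * 'X_1 ^+ 1)
  + c%:MP * ('X_0 ^+ 2 * 'X_1 ^+ 2) + d%:MP * ('X_0 ^+ 1 * 'X_1 ^+ 3)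
  + e%:MP * ('X_0 ^+ 0 * 'X_1 ^+ 4).

Lemma bcoefD (R : comNzRingType) (p q : {mpoly R[2]}) i j :
  bcoef (p + q) i j = bcoef p i j + bcoef q i j.
Proof. exact: mcoeffD. Qed.

Lemma bcoefCM (R : comNzRingType) c (p : {mpoly R[2]}) i j :
  bcoef (c%:MP * p) i j = c * bcoef p i j.
Proof. exact: mcoeffCM. Qed.

Definition form_simp := (bcoefD, bcoefCM, bcoefX, mulr0, mulr1, addr0, add0r).

Lemma homogCX (R : comNzRingType) (c : R) (i j : nat) :
  c%:MP * ('X_0 ^+ i * 'X_1 ^+ j : {mpoly R[2]}) \is (i + j).-homog.
Proof.
rewrite mul_mpolyC dhomogZ // !mpolyXn -mpolyXD -mnm2E dhomogX /= mdegE.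
by rewrite !big_ord_recl big_ord0 addn0 !multinomE !(tnth_nth 0%N).
Qed.

Lemma quad_form_homog (R : comNzRingType) (a b c : R) :
  quad_form a b c \is 2.-homog.
Proof. by rewrite /quad_form !rpredD ?homogCX //. Qed.

Lemma quartic_form_homog (R : comNzRingType) (a b c d e : R) :
  quartic_form a b c d e \is 4.-homog.
Proof. by rewrite /quartic_form !rpredD ?homogCX. Qed.

Lemma quad_formE (R : comNzRingType) (f : {mpoly R[2]}) :
  f \is 2.-homog -> f = quad_form (bcoef f 2 0) (bcoef f 1 1) (bcoef f 0 2).
Proof.
move=> hf; apply: (homog2_eq hf (quad_form_homog _ _ _)) => i j.
by case: i j => [|[|[|i]]] [|[|[|j]]] //= _; rewrite /quad_form !form_simp.
Qed.

Lemma quartic_formE (R : comNzRingType) (F : {mpoly R[2]}) :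
  F \is 4.-homog ->
  F = quartic_form (bcoef F 4 0) (bcoef F 3 1) (bcoef F 2 2)
        (bcoef F 1 3) (bcoef F 0 4).
Proof.
move=> hF; apply: (homog2_eq hF (quartic_form_homog _ _ _ _ _)) => i j.
by case: i j => [|[|[|[|[|i]]]]] [|[|[|[|[|j]]]]] //= _;
  rewrite /quartic_form !form_simp.
Qed.

Lemma quartic_form_inj (R : comNzRingType) (a b c d e a' b' c' d' e' : R) :
  quartic_form a b c d e = quartic_form a' b' c' d' e' ->
  [/\ a = a', b = b', c = c', d = d' & e = e'].
Proof.
move=> E; split.
- by move/(congr1 (fun p => bcoef p 4 0)): E; rewrite /quartic_form !form_simp.
- by move/(congr1 (fun p => bcoef p 3 1)): E; rewrite /quartic_form !form_simp.
- by move/(congr1 (fun p => bcoef p 2 2)): E; rewrite /quartic_form !form_simp.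
- by move/(congr1 (fun p => bcoef p 1 3)): E; rewrite /quartic_form !form_simp.
- by move/(congr1 (fun p => bcoef p 0 4)): E; rewrite /quartic_form !form_simp.
Qed.

Lemma quartic_form_comp (R : comNzRingType) (a b c d e : R) (T : 'M[R]_2) :
  let t1 := T 0 0 in let t2 := T 0 1 in let t3 := T 1 0 in let t4 := T 1 1 in
  quartic_form a b c d e
    \mPo [tuple \sum_(j < 2) T i j *: 'X_j | i < 2] =
  quartic_form
    (a * t1 ^+ 4 + b * t1 ^+ 3 * t3 + c * t1 ^+ 2 * t3 ^+ 2 + d * t1 * t3 ^+ 3
      + e * t3 ^+ 4)
    (4 * a * t1 ^+ 3 * t2 + b * (t1 ^+ 3 * t4 + 3 * t1 ^+ 2 * t2 * t3)
      + 2 * c * t1 * t3 * (t1 * t4 + t2 * t3)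
      + d * (t2 * t3 ^+ 3 + 3 * t1 * t3 ^+ 2 * t4) + 4 * e * t3 ^+ 3 * t4)
    (6 * a * t1 ^+ 2 * t2 ^+ 2 + 3 * b * t1 * t2 * (t1 * t4 + t2 * t3)
      + c * (t1 ^+ 2 * t4 ^+ 2 + 4 * t1 * t2 * t3 * t4 + t2 ^+ 2 * t3 ^+ 2)
      + 3 * d * t3 * t4 * (t1 * t4 + t2 * t3) + 6 * e * t3 ^+ 2 * t4 ^+ 2)
    (4 * a * t1 * t2 ^+ 3 + b * (t2 ^+ 3 * t3 + 3 * t1 * t2 ^+ 2 * t4)
      + 2 * c * t2 * t4 * (t1 * t4 + t2 * t3)
      + d * (t1 * t4 ^+ 3 + 3 * t2 * t3 * t4 ^+ 2) + 4 * e * t3 * t4 ^+ 3)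
    (a * t2 ^+ 4 + b * t2 ^+ 3 * t4 + c * t2 ^+ 2 * t4 ^+ 2 + d * t2 * t4 ^+ 3
      + e * t4 ^+ 4).
Proof.
move=> t1 t2 t3 t4.
have XE i : 'X_i \mPo [tuple \sum_(j < 2) T i j *: 'X_j | i < 2]
    = (T i 0)%:MP * 'X_0 + (T i 1)%:MP * 'X_1.
  rewrite comp_mpolyXU -tnth_nth tnth_mktuple !big_ord_recl big_ord0 addr0.
  by rewrite !mul_mpolyC; congr (_ *: _ + T i _ *: 'X__); apply: val_inj.
rewrite /quartic_form !rmorphD !rmorphM /= !comp_mpolyC !rmorphXn /= !XE.
rewrite -/t1 -/t2 -/t3 -/t4.
ring.
Qed.

(** * Eigenvectors of the transvectant *)

(** Vanishing of the 2x2 minors: no factor has to be exhibited, and over a field the negation is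
    linear independence. *)
Definition proportional (R : comNzRingType) (u v : R * R * R) : Prop :=
  [/\ u.1.1 * v.1.2 = u.1.2 * v.1.1, u.1.1 * v.2 = u.2 * v.1.1
    & u.1.2 * v.2 = u.2 * v.1.2].

Definition scale3 (R : comNzRingType) (k : R) (u : R * R * R) : R * R * R :=
  (k * u.1.1, k * u.1.2, k * u.2).

Lemma proportionalP (K : fieldType) (u v : K * K * K) :
  u != (0, 0, 0) -> proportional u v -> exists k, v = scale3 k u.
Proof.
case: u v => [[a b] c] [[x y] z]; rewrite /proportional /scale3 /= => n0 [h1 h2 h3].
have [a0|a0] := eqVneq a 0; last first.
  exists (x / a); congr (_, _, _).
  - by rewrite divfK.
  - by apply: (mulfI a0); rewrite h1; field.
  - by apply: (mulfI a0); rewrite h2; field.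
have [b0|b0] := eqVneq b 0; last first.
  exists (y / b); congr (_, _, _).
  - by apply: (mulfI b0); rewrite -h1; field.
  - by rewrite divfK.
  - by apply: (mulfI b0); rewrite h3; field.
have c0 : c != 0 by apply: contraNneq n0 => c0; rewrite a0 b0 c0.
exists (z / c); congr (_, _, _).
- by apply: (mulfI c0); rewrite -h2; field.
- by apply: (mulfI c0); rewrite -h3; field.
- by rewrite divfK.
Qed.

Definition dot3 (R : comNzRingType) (u v : R * R * R) : R :=
  u.1.1 * v.1.1 + u.1.2 * v.1.2 + u.2 * v.2.

(** Vectors orthogonal to two independent vectors are multiples of their cross product [w]. *)
Lemma orthogonal_line (K : fieldType) (f g r s : K * K * K) :
  ~ proportional f g -> dot3 r f = 0 -> dot3 r g = 0 -> dot3 s f = 0 ->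
  dot3 s g = 0 -> proportional r s.
Proof.
case: f g => [[f0 f1] f2] [[g0 g1] g2] nprop rf rg sf sg.
pose w := (f1 * g2 - f2 * g1, f2 * g0 - f0 * g2, f0 * g1 - f1 * g0).
have w_neq0 : w != (0, 0, 0).
  apply/eqP => -[w0 w1 w2]; apply: nprop; split=> /=.
  - exact: subr0_eq.
  - exact/esym/subr0_eq.
  - exact: subr0_eq.
have normal x : dot3 x (f0, f1, f2) = 0 -> dot3 x (g0, g1, g2) = 0 ->
    exists k, x = scale3 k w.
  case: x => [[x0 x1] x2] xf xg; apply: proportionalP => //.
  split; apply/eqP; rewrite -subr_eq0; apply/eqP.
  (* Up to sign, the three minors are the coordinates of w × x = (x·f) g - (x·g) f. *)
  - transitivity (g2 * dot3 (x0, x1, x2) (f0, f1, f2)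
      - f2 * dot3 (x0, x1, x2) (g0, g1, g2)); first by rewrite /dot3 /=; ring.
    by rewrite xf xg !mulr0 subrr.
  - transitivity (f1 * dot3 (x0, x1, x2) (g0, g1, g2)
      - g1 * dot3 (x0, x1, x2) (f0, f1, f2)); first by rewrite /dot3 /=; ring.
    by rewrite xf xg !mulr0 subrr.
  - transitivity (g0 * dot3 (x0, x1, x2) (f0, f1, f2)
      - f0 * dot3 (x0, x1, x2) (g0, g1, g2)); first by rewrite /dot3 /=; ring.
    by rewrite xf xg !mulr0 subrr.
have [[k ->] [l ->]] := (normal r rf rg, normal s sf sg).
by rewrite /proportional /scale3 /=; split; ring.
Qed.

Lemma quartic_formZ (R : comNzRingType) (k a b c d e : R) :
  quartic_form (k * a) (k * b) (k * c) (k * d) (k * e)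
  = k *: quartic_form a b c d e.
Proof. by rewrite /quartic_form -mul_mpolyC !mpolyCM; ring. Qed.

Lemma det_mx2E (R : comNzRingType) (T : 'M[R]_2) :
  \det T = T 0 0 * T 1 1 - T 0 1 * T 1 0.
Proof.
rewrite (expand_det_row _ 0) !big_ord_recl big_ord0 /cofactor !det_mx11 !mxE /=.
rewrite /bump /= expr0 expr1 mul1r mulN1r addr0 mulrN.
by congr (_ * T _ _ - T _ _ * T _ _); apply: val_inj.
Qed.

Section Transvectant.
Variables (K : numFieldType) (F : {mpoly K[2]}).
Let a4 := bcoef F 4 0.
Let a3 := bcoef F 3 1.
Let a2 := bcoef F 2 2.
Let a1 := bcoef F 1 3.
Let a0 := bcoef F 0 4.

(* A triple (al, be, ga) stands for the form al x^2 + be xy + ga y^2; this is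
   half of F_xx f_yy - 2 F_xy f_xy + F_yy f_xx. *)
Definition transvectant (f : K * K * K) : K * K * K :=
  (2 * a2 * f.1.1 - 3 * a3 * f.1.2 + 12 * a4 * f.2,
   6 * a1 * f.1.1 - 4 * a2 * f.1.2 + 6 * a3 * f.2,
   12 * a0 * f.1.1 - 3 * a1 * f.1.2 + 2 * a2 * f.2).

Definition disc3 (f : K * K * K) : K := f.1.2 ^+ 2 - 4 * f.1.1 * f.2.

(** The symmetric bilinear form with [polar3 f f = disc3 f]. *)
Definition polar3 (f g : K * K * K) : K :=
  f.1.2 * g.1.2 - 2 * (f.1.1 * g.2 + f.2 * g.1.1).

Definition eigen mu f := transvectant f = scale3 mu f.

(* The form with these coefficients is f with 2 T = (tr T) I + M_f: its roots
   are the fixed points of T. *)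
Lemma nonscalar_axis_neq0 (T : 'M[K]_2) :
  ~~ is_scalar_mx T -> (- T 1 0, T 0 0 - T 1 1, T 0 1) != (0, 0, 0).
Proof.
apply: contra => /eqP [/eqP]; rewrite oppr_eq0 => /eqP t30 t14 t20.
apply/is_scalar_mxP; exists (T 0 0); apply/matrixP => i j; rewrite !mxE.
case: i j => [[|[|//]] ?] [[|[|//]] ?] /=; rewrite ?mulr1n ?mulr0n.
- by congr (T _ _); apply: val_inj.
- by rewrite -t20; congr (T _ _); apply: val_inj.
- by rewrite -t30; congr (T _ _); apply: val_inj.
- by rewrite (subr0_eq t14); congr (T _ _); apply: val_inj.
Qed.

(** The triple is the form f attached to T above. It satisfies f o T = (det T) f, and for nonscalar
    invertible T the forms with this property are the multiples of f; the transvectant of f turns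
    out to be one of them. *)
Lemma transvectant_fixed (T : 'M[K]_2) :
  T \in unitmx -> ~~ is_scalar_mx T -> F \is 4.-homog ->
  F \mPo [tuple \sum_(j < 2) T i j *: 'X_j | i < 2] = \det T ^+ 2 *: F ->
  exists mu, eigen mu (- T 1 0, T 0 0 - T 1 1, T 0 1).
Proof.
rewrite unitmxE unitfE => detT nscal hF.
rewrite [in X in X \mPo _](quartic_formE hF) quartic_form_comp.
rewrite [in X in _ = _ *: X](quartic_formE hF) -quartic_formZ.
rewrite -/a4 -/a3 -/a2 -/a1 -/a0 => /quartic_form_inj.
move: detT; rewrite det_mx2E; set t1 := T 0 0; set t2 := T 0 1.
set t3 := T 1 0; set t4 := T 1 1; set d := (t1 * t4 - t2 * t3).
move=> d_neq0 [e4 e3 e2 e1 e0].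
set f := (_, _, _).
have f_neq0 : f != (0, 0, 0) := nonscalar_axis_neq0 nscal.
case E: (transvectant f) => [[g0 g1] g2].
have [E0 E1 E2] := E.
(* As f o T = d f and the transvectant is equivariant, g o T = d g. *)
move: e4 e3 e2 e1 e0.
set A4 := (X in X = _); set A3 := (X in _ -> X = _ -> _).
set A2 := (X in _ -> _ -> X = _ -> _); set A1 := (X in _ -> _ -> _ -> X = _ -> _).
set A0 := (X in _ -> _ -> _ -> _ -> X = _ -> _).
move=> e4 e3 e2 e1 e0.
have d2_neq0 := expf_neq0 2 d_neq0.
(* [p0], [p1], [p2] are the coefficients of g o T - d g. Each first [transitivity] is equivariance,
   d^2 (g o T) = d times the transvectant of F o T with f; then F o T = d^2 F is inserted. *)
have p0 : g0 * t1 ^+ 2 + g1 * t1 * t3 + g2 * t3 ^+ 2 - d * g0 = 0.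
  apply: (mulfI d2_neq0); rewrite mulr0 mulrBr.
  transitivity (d * (2 * A2 * f.1.1 - 3 * A3 * f.1.2 + 12 * A4 * f.2)
    - d ^+ 2 * (d * g0)); first by rewrite -E0 -E1 -E2 /A2 /A3 /A4 /d /=; ring.
  by rewrite e2 e3 e4 -E0 /f /=; ring.
have p1 : 2 * g0 * t1 * t2 + g1 * (t1 * t4 + t2 * t3) + 2 * g2 * t3 * t4
    - d * g1 = 0.
  apply: (mulfI d2_neq0); rewrite mulr0 mulrBr.
  transitivity (d * (6 * A1 * f.1.1 - 4 * A2 * f.1.2 + 6 * A3 * f.2)
    - d ^+ 2 * (d * g1)); first by rewrite -E0 -E1 -E2 /A1 /A2 /A3 /d /=; ring.
  by rewrite e1 e2 e3 -E1 /f /=; ring.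
have p2 : g0 * t2 ^+ 2 + g1 * t2 * t4 + g2 * t4 ^+ 2 - d * g2 = 0.
  apply: (mulfI d2_neq0); rewrite mulr0 mulrBr.
  transitivity (d * (12 * A0 * f.1.1 - 3 * A1 * f.1.2 + 2 * A2 * f.2)
    - d ^+ 2 * (d * g2)); first by rewrite -E0 -E1 -E2 /A0 /A1 /A2 /d /=; ring.
  by rewrite e0 e1 e2 -E2 /f /=; ring.
apply: (proportionalP f_neq0); rewrite E /f.
have d2' : 2 * d != 0 by rewrite mulf_neq0 ?pnatr_eq0.
(* 2 d times each minor of f and g is a linear combination of the coefficients of g o T - d g. *)
split=> /=; apply/eqP; rewrite -subr_eq0; apply/eqP; apply: (mulfI d2');
  rewrite mulr0; move: p0 p1 p2.
- set q0 := (X in X = _); set q1 := (X in _ -> X = _ -> _) => p0 p1 _.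
  transitivity (t3 * q1 - 2 * t4 * q0); first by rewrite /q0 /q1 /d; ring.
  by rewrite p0 p1 !mulr0 subrr.
- set q0 := (X in X = _); set q1 := (X in _ -> X = _ -> _) => p0 p1 _.
  transitivity (2 * t2 * q0 - t1 * q1); first by rewrite /q0 /q1 /d; ring.
  by rewrite p0 p1 !mulr0 subrr.
- set q0 := (X in X = _); set q1 := (X in _ -> X = _ -> _).
  set q2 := (X in _ -> _ -> X = _ -> _) => _ p1 p2.
  transitivity (t2 * q1 - 2 * t1 * q2); first by rewrite /q1 /q2 /d; ring.
  by rewrite p1 p2 !mulr0 subrr.
Qed.

Lemma eigen_fixed (mu : K) (f : K * K * K) (T : 'M[K]_2) :
  F \is 4.-homog -> eigen mu f ->
  T 0 0 = f.1.2 -> T 0 1 = 2 * f.2 -> T 1 0 = - (2 * f.1.1) -> T 1 1 = - f.1.2 ->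
  F \mPo [tuple \sum_(j < 2) T i j *: 'X_j | i < 2] = disc3 f ^+ 2 *: F.
Proof.
case: f => [[al be] ga] hF [] /= E0 E1 E2 T0 T1 T2 T3.
rewrite [in X in X \mPo _](quartic_formE hF) quartic_form_comp.
rewrite [in X in _ = _ *: X](quartic_formE hF) -quartic_formZ.
rewrite -/a4 -/a3 -/a2 -/a1 -/a0 in E0 E1 E2 *.
rewrite T0 T1 T2 T3 /disc3 /=.
have n3 : 3 != 0 :> K by rewrite pnatr_eq0.
set e0 := (X in X = _) in E0; set e1 := (X in X = _) in E1; set e2 := (X in X = _) in E2.
have p01 : al * e1 - be * e0 = 0 by rewrite E0 E1; ring.
have p02 : al * e2 - ga * e0 = 0 by rewrite E0 E2; ring.
have p12 : be * e2 - ga * e1 = 0 by rewrite E1 E2; ring.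
(* With g the transvectant, [p, q] = (p_x q_y - p_y q_x) / 2 and E = [f, g],
   3 (F o M_f - disc(f)^2 F) = 2 f [f, E], and u0, u1, u2 are the coefficients
   of [f, E]. *)
pose q01 := al * e1 - be * e0; pose q02 := al * e2 - ga * e0.
pose q12 := be * e2 - ga * e1.
pose u0 := al * (2 * q02) - be * q01; pose u1 := 2 * (al * q12 - ga * q01).
pose u2 := be * q12 - ga * (2 * q02).
have u0_eq0 : u0 = 0 by rewrite /u0 /q01 /q02 p01 p02 !mulr0 subrr.
have u1_eq0 : u1 = 0 by rewrite /u1 /q01 /q12 p01 p12 !mulr0 subrr mulr0.
have u2_eq0 : u2 = 0 by rewrite /u2 /q02 /q12 p02 p12 !mulr0 subrr.
congr quartic_form; apply/eqP; rewrite -subr_eq0; apply/eqP; apply: (mulfI n3);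
  rewrite mulr0.
- transitivity (2 * (al * u0)); last by rewrite u0_eq0 !mulr0.
  by rewrite /u0 /q01 /q02 /e0 /e1 /e2; ring.
- transitivity (2 * (al * u1 + be * u0)); last by rewrite u0_eq0 u1_eq0; ring.
  by rewrite /u0 /u1 /q01 /q02 /q12 /e0 /e1 /e2; ring.
- transitivity (2 * (al * u2 + be * u1 + ga * u0)).
    by rewrite /u0 /u1 /u2 /q01 /q02 /q12 /e0 /e1 /e2; ring.
  by rewrite u0_eq0 u1_eq0 u2_eq0; ring.
- transitivity (2 * (be * u2 + ga * u1)); last by rewrite u2_eq0 u1_eq0; ring.
  by rewrite /u1 /u2 /q01 /q02 /q12 /e0 /e1 /e2; ring.
- transitivity (2 * (ga * u2)); last by rewrite u2_eq0 !mulr0.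
  by rewrite /u2 /q02 /q12 /e0 /e1 /e2; ring.
Qed.

(** A nonzero f of discriminant 0 is a multiple of l^2 for a linear form l. If it is an eigenvector,
    then l^2 divides F and the discriminant of F vanishes. *)
Lemma eigen_disc_neq0 (mu : K) (f : K * K * K) :
  f != (0, 0, 0) -> 4 * quartic_I F ^+ 3 != quartic_J F ^+ 2 ->
  eigen mu f -> disc3 f != 0.
Proof.
case: f => [[al be] ga] f0; rewrite /quartic_I /quartic_J /disc3 -/a4 -/a3 -/a2 -/a1 -/a0.
move=> D0 [] /= E0 E1 E2; rewrite -/a4 -/a3 -/a2 -/a1 -/a0 in E0 E1 E2.
have [n2 n3] : (2 != 0 :> K) /\ (3 != 0 :> K) by rewrite !pnatr_eq0.
have n6 : 6 != 0 :> K by rewrite pnatr_eq0.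
have n12 : 12 != 0 :> K by rewrite pnatr_eq0.
apply: contra_neqN D0 => /eqP /subr0_eq D0.
have [al0|al0] := eqVneq al 0.
  (* Here f = ga y^2, and y^2 divides F. *)
  have be0 : be = 0 by apply/eqP; rewrite -sqrf_eq0 D0 al0 mulr0 mul0r.
  have ga0 : ga != 0 by apply: contraNneq f0 => ->; rewrite al0 be0.
  have a40 : a4 = 0.
    apply: (mulfI n12); apply: (mulIf ga0); transitivity (mu * al).
      by rewrite -E0 al0 be0; ring.
    by rewrite al0; ring.
  have a30 : a3 = 0.
    apply: (mulfI n6); apply: (mulIf ga0); transitivity (mu * be).
      by rewrite -E1 al0 be0; ring.
    by rewrite be0; ring.
  by rewrite a40 a30; ring.
(* f = al (x + s y)^2, and F = (x + s y)^2 * (quadratic form). *)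
pose s := be / (2 * al).
have bes : be = 2 * s * al by rewrite /s; field.
have gas : ga = s ^+ 2 * al.
  have n4 : 4 * al != 0 by rewrite mulf_neq0 ?pnatr_eq0.
  by apply: (mulfI n4); rewrite -D0 bes; ring.
have mu0 : mu = 2 * a2 - 6 * a3 * s + 12 * a4 * s ^+ 2.
  by apply: (mulIf al0); rewrite -E0 bes gas; ring.
have a1E : a1 = 2 * a2 * s - 3 * a3 * s ^+ 2 + 4 * a4 * s ^+ 3.
  apply: (mulfI n6); apply: (mulIf al0).
  have -> : 6 * a1 * al = mu * be + 4 * a2 * be - 6 * a3 * ga by rewrite -E1; ring.
  by rewrite mu0 bes gas; ring.
have a0E : a0 = a2 * s ^+ 2 - 2 * a3 * s ^+ 3 + 3 * a4 * s ^+ 4.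
  apply: (mulfI n12); apply: (mulIf al0).
  have -> : 12 * a0 * al = mu * ga + 3 * a1 * be - 2 * a2 * ga by rewrite -E2; ring.
  by rewrite mu0 bes gas a1E; ring.
by rewrite a1E a0E; ring.
Qed.

(** B_F is self-adjoint for [polar3], so (mu - nu) [polar3 f g] = 0. *)
Lemma eigen_orthogonal (mu nu : K) (f g : K * K * K) :
  mu != nu -> eigen mu f -> eigen nu g -> polar3 f g = 0.
Proof.
case: f g => [[al be] ga] [[x y] z] mn [E0 E1 E2] [] /= G0 G1 G2.
rewrite -subr_eq0 in mn; apply: (mulfI mn); rewrite mulr0 /polar3 /=.
rewrite /= in E0 E1 E2.
transitivity ((mu * be) * y - 2 * ((mu * al) * z + (mu * ga) * x)
  - (be * (nu * y) - 2 * (al * (nu * z) + ga * (nu * x)))); first by ring.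
by rewrite -E0 -E1 -E2 -G0 -G1 -G2; ring.
Qed.

Lemma root_resolventE (z : K) :
  root (cubic_resolvent F) z = (z ^+ 3 - 3 * quartic_I F * z + quartic_J F == 0).
Proof.
by rewrite rootE /cubic_resolvent !(hornerD, hornerN, hornerXn, hornerZ, hornerX, hornerC).
Qed.

(* The triples are the rows of B_F + 2 z. *)
Lemma eigen_rows (z : K) (f : K * K * K) :
  eigen (- 2 * z) f ->
  [/\ dot3 (2 * a2 + 2 * z, - 3 * a3, 12 * a4) f = 0,
      dot3 (6 * a1, 2 * z - 4 * a2, 6 * a3) f = 0
    & dot3 (12 * a0, - 3 * a1, 2 * a2 + 2 * z) f = 0].
Proof.
case: f => [[al be] ga] [] /= E0 E1 E2; rewrite /dot3 /=; split.
- by transitivity (- 2 * z * al + 2 * z * al); [rewrite -E0|]; rewrite -/a4 -/a3 -/a2; ring.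
- by transitivity (- 2 * z * be + 2 * z * be); [rewrite -E1|]; rewrite -/a1 -/a3 -/a2; ring.
- by transitivity (- 2 * z * ga + 2 * z * ga); [rewrite -E2|]; rewrite -/a0 -/a1 -/a2; ring.
Qed.

(** Two independent vectors in the kernel of B_F + 2 z make its rows pairwise proportional. Its 2x2
    minors then vanish, so z is a multiple root of the resolvent. *)
Lemma eigen_simple (z : K) (f g : K * K * K) :
  root (cubic_resolvent F) z -> eigen (- 2 * z) f -> eigen (- 2 * z) g ->
  ~ proportional f g -> 4 * quartic_I F ^+ 3 = quartic_J F ^+ 2.
Proof.
move=> rz /eigen_rows [f0 f1 f2] /eigen_rows [g0 g1 g2] nfg.
have [m01 _ _] := orthogonal_line nfg f0 g0 f1 g1.
have [_ m02 _] := orthogonal_line nfg f0 g0 f2 g2.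
have [_ _ m12] := orthogonal_line nfg f1 g1 f2 g2.
rewrite /= in m01 m02 m12.
move: rz; rewrite root_resolventE => /eqP rz.
(* The sum of the principal 2x2 minors of B_F + 2 z is 12 (z^2 - I) = 4 Q_F'(z). *)
have Iz : quartic_I F = z ^+ 2.
  have n12 : 12 != 0 :> K by rewrite pnatr_eq0.
  apply/esym/subr0_eq/(mulfI n12); rewrite mulr0.
  transitivity (((2 * a2 + 2 * z) * (2 * z - 4 * a2) - - 3 * a3 * (6 * a1))
    + ((2 * a2 + 2 * z) * (2 * a2 + 2 * z) - 12 * a4 * (12 * a0))
    + ((2 * z - 4 * a2) * (2 * a2 + 2 * z) - 6 * a3 * (- 3 * a1))).
    by rewrite /quartic_I -/a4 -/a3 -/a2 -/a1 -/a0; ring.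
  by rewrite m01 m02 m12 !subrr !addr0.
have -> : quartic_J F = 3 * quartic_I F * z - z ^+ 3.
  by apply/eqP; rewrite -subr_eq0 -[X in _ == X]rz; apply/eqP; ring.
by rewrite Iz; ring.
Qed.

(** The adjugate of B_F + 2 z applied to (B_F + 2 z) f = 0 gives 8 Q_F(z) f = 0. The multipliers of
    [r0], [r1], [r2] below are the rows of this adjugate. *)
Lemma eigen_root (mu : K) (f : K * K * K) :
  f != (0, 0, 0) -> eigen mu f -> root (cubic_resolvent F) (- (mu / 2)).
Proof.
case: f => [[al be] ga] f0.
have n2 : 2 != 0 :> K by rewrite pnatr_eq0.
have n8 : 8 != 0 :> K by rewrite pnatr_eq0.
set z := - (mu / 2); have -> : mu = - 2 * z by rewrite /z; field.
move=> /eigen_rows []; rewrite /dot3 /= => E0 E1 E2.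
rewrite root_resolventE; set Q := (X in X == 0).
move: E0 E1 E2; set r0 := (X in X = 0); set r1 := (X in _ -> X = 0 -> _).
set r2 := (X in _ -> _ -> X = 0 -> _) => E0 E1 E2.
have Qal : Q * al = 0.
  apply: (mulfI n8); rewrite mulr0.
  transitivity (((2 * z - 4 * a2) * (2 * a2 + 2 * z) - 6 * a3 * (- 3 * a1)) * r0
    - (- 3 * a3 * (2 * a2 + 2 * z) - 12 * a4 * (- 3 * a1)) * r1
    + (- 3 * a3 * (6 * a3) - 12 * a4 * (2 * z - 4 * a2)) * r2).
    rewrite /Q /r0 /r1 /r2 /quartic_I /quartic_J -/a4 -/a3 -/a2 -/a1 -/a0.
    by ring.
  by rewrite E0 E1 E2; ring.
have Qbe : Q * be = 0.
  apply: (mulfI n8); rewrite mulr0.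
  transitivity (- (6 * a1 * (2 * a2 + 2 * z) - 6 * a3 * (12 * a0)) * r0
    + ((2 * a2 + 2 * z) ^+ 2 - 12 * a4 * (12 * a0)) * r1
    - ((2 * a2 + 2 * z) * (6 * a3) - 12 * a4 * (6 * a1)) * r2).
    rewrite /Q /r0 /r1 /r2 /quartic_I /quartic_J -/a4 -/a3 -/a2 -/a1 -/a0.
    by ring.
  by rewrite E0 E1 E2; ring.
have Qga : Q * ga = 0.
  apply: (mulfI n8); rewrite mulr0.
  transitivity ((6 * a1 * (- 3 * a1) - (2 * z - 4 * a2) * (12 * a0)) * r0
    - ((2 * a2 + 2 * z) * (- 3 * a1) - - 3 * a3 * (12 * a0)) * r1
    + ((2 * a2 + 2 * z) * (2 * z - 4 * a2) - - 3 * a3 * (6 * a1)) * r2).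
    rewrite /Q /r0 /r1 /r2 /quartic_I /quartic_J -/a4 -/a3 -/a2 -/a1 -/a0.
    by ring.
  by rewrite E0 E1 E2; ring.
apply: contraNT f0 => Q0; apply/eqP; congr (_, _, _); apply: (mulfI Q0);
  by rewrite mulr0.
Qed.

Lemma root_eigen (z : K) :
  root (cubic_resolvent F) z -> exists2 f, f != (0, 0, 0) & eigen (- 2 * z) f.
Proof.
rewrite root_resolventE => /eqP rz.
(* [M] is the transpose of B_F + 2 z, since [det0P] yields a row vector killed from the left. *)
pose M : 'M[K]_3 := \matrix_(i, j)
  nth 0 (nth [::] [:: [:: 2 * a2 + 2 * z; 6 * a1; 12 * a0];
      [:: - 3 * a3; 2 * z - 4 * a2; - 3 * a1];
      [:: 12 * a4; 6 * a3; 2 * a2 + 2 * z]] i) j.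
have detM : \det M = 0.
  rewrite (expand_det_row _ 0) !big_ord_recl big_ord0 /cofactor !det_mx2E !mxE /=.
  rewrite /bump /=; transitivity (8 * (z ^+ 3 - 3 * quartic_I F * z + quartic_J F)).
    by rewrite /quartic_I /quartic_J -/a4 -/a3 -/a2 -/a1 -/a0; ring.
  by rewrite rz mulr0.
have /det0P [v v0 vM] : \det M == 0 by rewrite detM.
exists (v 0 0, v 0 1, v 0 2%:R).
  apply: contraNneq v0 => -[v00 v01 v02]; apply/eqP/rowP => j; rewrite mxE.
  by case: j => [[|[|[|//]]] ?]; [rewrite -v00|rewrite -v01|rewrite -v02];
    congr (v _ _); apply: val_inj.
have col j := congr1 (fun w : 'rV_3 => w 0 j) vM.
have o1 : lift 0 (0 : 'I_2) = 1 :> 'I_3 by apply: val_inj.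
have o2 : lift 0 (lift 0 (0 : 'I_1)) = 2%:R :> 'I_3 by apply: val_inj.
move: (col 0) (col 1) (col 2%:R).
rewrite !mxE !big_ord_recl !big_ord0 !mxE /= o1 o2 => c0 c1 c2.
rewrite /eigen /transvectant /scale3 /= -/a4 -/a3 -/a2 -/a1 -/a0.
congr (_, _, _); apply/eqP; rewrite -subr_eq0; apply/eqP.
- by rewrite -[RHS]c0; ring.
- by rewrite -[RHS]c1; ring.
- by rewrite -[RHS]c2; ring.
Qed.

End Transvectant.

(** * Primitive integral eigenvectors *)

Lemma bcoef_toQ (p : {mpoly int[2]}) i j : bcoef (toQ p) i j = (bcoef p i j)%:~R.
Proof. exact: mcoeff_map_mpoly. Qed.

Lemma homog_toQ (d : nat) (p : {mpoly int[2]}) :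
  p \is d.-homog -> toQ p \is d.-homog.
Proof.
move=> /dhomogP hp; apply/dhomogP => m; rewrite mcoeff_msupp mcoeff_map_mpoly.
by rewrite intr_eq0 -mcoeff_msupp; apply: hp.
Qed.

(** Clears the inverse determinant from [twist]. As F is nonzero, [msize] reads its degree as 4, so
    the exponent is 2. *)
Lemma twist_quarticE (K : fieldType) (F : {mpoly K[2]}) (T : 'M[K]_2) :
  F \is 4.-homog -> F != 0 -> T \in unitmx ->
  twist F T = F <->
  F \mPo [tuple \sum_(j < 2) T i j *: 'X_j | i < 2] = \det T ^+ 2 *: F.
Proof.
move=> hF F0; rewrite unitmxE unitfE => T0; rewrite /twist.
have -> : (msize F).-1 = 4%N.
  by apply/esym/(dhomog_uniq F0 hF); exact: dhomog_msize hF.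
have T2 : \det T ^+ 2 != 0 by rewrite expf_neq0.
split=> [{2}<-|->]; rewrite scalerA ?mulfV ?mulVf ?scale1r //.
Qed.

Lemma eigenZ (K : numFieldType) (F : {mpoly K[2]}) (mu k : K) (f : K * K * K) :
  eigen F mu f -> eigen F mu (scale3 k f).
Proof.
case: f => [[x y] z] [] /= E0 E1 E2; rewrite /eigen /transvectant /scale3 /=.
congr (_, _, _).
- by rewrite [RHS]mulrCA -E0; ring.
- by rewrite [RHS]mulrCA -E1; ring.
- by rewrite [RHS]mulrCA -E2; ring.
Qed.

Lemma eigen_unique (K : numFieldType) (F : {mpoly K[2]}) (mu nu : K)
    (f : K * K * K) :
  f != (0, 0, 0) -> eigen F mu f -> eigen F nu f -> mu = nu.
Proof.
move=> f0 Ef; rewrite /eigen Ef; case: f f0 {Ef} => [[x y] z] f0 [] /= E0 E1 E2.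
apply/eqP; rewrite -subr_eq0; apply: contraNT f0 => n; apply/eqP.
by congr (_, _, _); apply: (mulfI n); rewrite mulr0 mulrBl ?E0 ?E1 ?E2 subrr.
Qed.

Definition coefs (f : {mpoly int[2]}) : rat * rat * rat :=
  ((bcoef f 2 0)%:~R, (bcoef f 1 1)%:~R, (bcoef f 0 2)%:~R).

Lemma disc3_coefs (f : {mpoly int[2]}) : disc3 (coefs f) = (quad_disc f)%:~R.
Proof.
rewrite /disc3 /quad_disc /=.
by move: (bcoef f 2 0) (bcoef f 1 1) (bcoef f 0 2) => a b c; ring.
Qed.

Lemma primitive_neq0 (f : {mpoly int[2]}) : quad_primitive f -> coefs f != (0, 0, 0).
Proof.
rewrite /quad_primitive /coefs => h; apply/eqP => -[] /eqP; rewrite intr_eq0.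
move=> /eqP E0 /eqP; rewrite intr_eq0 => /eqP E1 /eqP; rewrite intr_eq0 => /eqP E2.
by move: h; rewrite E0 E1 E2 !gcdz0.
Qed.

(** A cubic without roots in the field has no proper factor, as one of two proper factors would be
    linear. Classical logic turns the negated irreducibility into a root. *)
Lemma reducible_resolventP (F : {mpoly rat[2]}) :
  ~ irreducible_poly (cubic_resolvent F) <->
  exists z, root (cubic_resolvent F) z.
Proof.
have sQ : size (cubic_resolvent F) = 4%N.
  rewrite /cubic_resolvent -addrA size_polyDl size_polyXn //.
  rewrite (leq_ltn_trans (size_polyD _ _)) // gtn_max.
  rewrite size_polyN (leq_ltn_trans (size_scale_leq _ _)) ?size_polyX //=.
  by rewrite (leq_ltn_trans (size_polyC_leq1 _)).
split=> [nirr|[z rz] [_ /(_ ('X - z%:P))]]; last first.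
  rewrite size_XsubC -root_factor_theorem => /(_ isT rz).
  by move/eqp_size; rewrite size_XsubC sQ.
apply: Classical_Prop.NNPP => nroot; apply: nirr.
apply: cubic_irreducible; first by rewrite sQ.
by move=> z; apply/negP => rz; apply: nroot; exists z.
Qed.

Lemma quartic_disc_neq0 (F : {mpoly rat[2]}) :
  quartic_disc F != 0 -> 4 * quartic_I F ^+ 3 != quartic_J F ^+ 2.
Proof. by apply: contra => /eqP; rewrite /quartic_disc => ->; rewrite subrr mul0r. Qed.

Lemma quartic_disc_toQ (F : {mpoly int[2]}) :
  exists D : int, quartic_disc (toQ F) = D%:~R.
Proof.
rewrite /quartic_disc /quartic_I /quartic_J !bcoef_toQ.
move: (bcoef F 4 0) (bcoef F 3 1) (bcoef F 2 2) (bcoef F 1 3) (bcoef F 0 4).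
move=> a b c d e.
(* The classical discriminant of a quartic; all of its coefficients are integers, so the division by
   27 is exact. *)
exists (256 * a ^+ 3 * e ^+ 3 - 192 * a ^+ 2 * b * d * e ^+ 2
  - 128 * a ^+ 2 * c ^+ 2 * e ^+ 2 + 144 * a ^+ 2 * c * d ^+ 2 * e
  - 27 * a ^+ 2 * d ^+ 4 + 144 * a * b ^+ 2 * c * e ^+ 2
  - 6 * a * b ^+ 2 * d ^+ 2 * e - 80 * a * b * c ^+ 2 * d * e
  + 18 * a * b * c * d ^+ 3 + 16 * a * c ^+ 4 * e - 4 * a * c ^+ 3 * d ^+ 2
  - 27 * b ^+ 4 * e ^+ 2 + 18 * b ^+ 3 * c * d * e - 4 * b ^+ 3 * d ^+ 3
  - 4 * b ^+ 2 * c ^+ 3 * e + b ^+ 2 * c ^+ 2 * d ^+ 2).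
by field.
Qed.

(** The denominator of r divides the square of the numerator and is coprime to the numerator, so it
    is 1. *)
Lemma sqr_intr (r : rat) (m : int) : r ^+ 2 = m%:~R -> exists n : int, r = n%:~R.
Proof.
move=> rm; exists (numq r); apply/esym/numqK; rewrite Qint_def.
have E : (numq r ^+ 2 = m * denq r ^+ 2)%R.
  by apply/eqP; rewrite -(eqr_int rat) rmorphXn /= rmorphM rmorphXn /= -rm -exprMn -numqE.
have : (denq r %| numq r ^+ 2)%Z by rewrite E dvdz_mull // dvdz_exp.
rewrite expr2 Gauss_dvdzr; last by rewrite coprimez_sym; exact: coprime_num_den.
move=> dv; have : (denq r %| gcdz (numq r) (denq r))%Z by rewrite dvdz_gcd dv dvdzz.
have /eqP -> : coprimez (numq r) (denq r) by exact: coprime_num_den.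
by rewrite dvdz1 -eqz_nat absz_denq.
Qed.

Lemma quartic_disc_form_neq0 (F : {mpoly rat[2]}) : quartic_disc F != 0 -> F != 0.
Proof.
move=> /quartic_disc_neq0; apply: contraNneq; rewrite /quartic_I /quartic_J /bcoef.
by move=> ->; rewrite !mcoeff0; apply/eqP; ring.
Qed.

Lemma quad_mx_coefs (f : {mpoly int[2]}) :
  let T := quad_mx (toQ f) in
  [/\ T 0 0 = (coefs f).1.2, T 0 1 = 2 * (coefs f).2,
      T 1 0 = - (2 * (coefs f).1.1) & T 1 1 = - (coefs f).1.2].
Proof. by split; rewrite !mxE !bcoef_toQ. Qed.

Lemma det_quad_mx (f : {mpoly int[2]}) :
  \det (quad_mx (toQ f)) = - (quad_disc f)%:~R.
Proof.
have [T00 T01 T10 T11] := quad_mx_coefs f; rewrite -disc3_coefs.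
by rewrite det_mx2E T00 T01 T10 T11 /disc3; case: (coefs f) => -[] *; ring.
Qed.

Lemma quad_mx_unit (f : {mpoly int[2]}) :
  (quad_mx (toQ f) \in unitmx) = (quad_disc f != 0).
Proof. by rewrite unitmxE unitfE det_quad_mx oppr_eq0 intr_eq0. Qed.

(** M_f has trace 0, so a scalar M_f would be zero, against det M_f = -disc(f). *)
Lemma quad_mx_nonscalar (f : {mpoly int[2]}) :
  quad_disc f != 0 -> ~~ is_scalar_mx (quad_mx (toQ f)).
Proof.
have [T00 T01 T10 T11] := quad_mx_coefs f.
apply: contra => /is_scalar_mxP [t TE].
have t0 : t = - t.
  move: T00 T11; rewrite TE !mxE !eqxx !mulr1n => e00 e11.
  by rewrite {1}e11 -e00.
have {}t0 : t = 0 by apply/eqP; rewrite -eqNr -t0.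
rewrite -(intr_eq0 rat) -oppr_eq0 -det_quad_mx TE t0.
by rewrite det_mx2E !mxE !mul0rn mulr0 subrr.
Qed.

(** The bridge to linear algebra: from here on only eigenvectors of B_F matter, and disc(f) <> 0
    comes for free from Delta(F) <> 0. *)
Lemma fixing_formP (F f : {mpoly int[2]}) :
  F \is 4.-homog -> quartic_disc (toQ F) != 0 ->
  fixing_form F f <->
  [/\ f \is 2.-homog, quad_primitive f & exists mu, eigen (toQ F) mu (coefs f)].
Proof.
move=> hF D0; have hFQ := homog_toQ hF; have D0' := quartic_disc_neq0 D0.
have FQ0 := quartic_disc_form_neq0 D0.
have [T00 T01 T10 T11] := quad_mx_coefs f.
split=> [[hf pf df tw]|[hf pf [mu Ef]]].
  split=> //; move: tw; rewrite twist_quarticE ?quad_mx_unit // => tw.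
  have [||mu E] := transvectant_fixed _ _ hFQ tw.
  - by rewrite quad_mx_unit.
  - exact: quad_mx_nonscalar.
  (* The form that [transvectant_fixed] attaches to T = M_f is 2 f. *)
  exists mu; set v := (_, _, _) in E; have -> : coefs f = scale3 (1 / 2) v.
    rewrite /v T00 T01 T10 T11 /scale3; case: (coefs f) => -[x y] z.
    by congr (_, _, _); cbn [fst snd]; field.
  exact: eigenZ.
have df : quad_disc f != 0.
  rewrite -(intr_eq0 rat) -disc3_coefs; apply: eigen_disc_neq0 Ef => //.
  exact: primitive_neq0.
split=> //; rewrite twist_quarticE ?quad_mx_unit //.
by rewrite (eigen_fixed hFQ Ef T00 T01 T10 T11) det_quad_mx sqrrN disc3_coefs.
Qed.

(** Denominators are cleared by their product [d], then the content [g] is divided out. *)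
Lemma primitive_scaling (v : rat * rat * rat) :
  v != (0, 0, 0) ->
  exists f k, [/\ f \is 2.-homog, quad_primitive f & coefs f = scale3 k v].
Proof.
case: v => [[x y] z] v0.
pose a := numq x * denq y * denq z; pose b := numq y * denq x * denq z.
pose c := numq z * denq x * denq y; pose d := denq x * denq y * denq z.
pose g := gcdz (gcdz a b) c.
have [dx dy dz] : [/\ (denq x)%:~R != 0 :> rat, (denq y)%:~R != 0 :> rat
    & (denq z)%:~R != 0 :> rat] by rewrite !intr_eq0 !denq_neq0.
have aE : a%:~R = d%:~R * x by rewrite !rmorphM /= numqE; ring.
have bE : b%:~R = d%:~R * y by rewrite !rmorphM /= numqE; ring.
have cE : c%:~R = d%:~R * z by rewrite !rmorphM /= numqE; ring.
have d0 : d%:~R != 0 :> rat by rewrite !rmorphM /= !mulf_neq0.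
have g0 : g != 0.
  rewrite !gcdz_eq0; apply: contra v0 => /andP[/andP[/eqP a0 /eqP b0] /eqP c0].
  apply/eqP; congr (_, _, _); apply: (mulfI d0); rewrite mulr0.
  - by rewrite -aE a0.
  - by rewrite -bE b0.
  - by rewrite -cE c0.
have [ga gb gc] : [/\ (g %| a)%Z, (g %| b)%Z & (g %| c)%Z].
  have := dvdzz g; rewrite {2}/g !dvdz_gcd => /andP[/andP[-> ->] ->] //.
exists (quad_form (a %/ g)%Z (b %/ g)%Z (c %/ g)%Z), (d%:~R / g%:~R).
split; first exact: quad_form_homog.
- rewrite /quad_primitive /quad_form !form_simp; apply/eqP.
  have mulg m n : gcdz m n * g = gcdz (m * g) (n * g) by rewrite -mulz_gcdl.
  by apply: (mulIf g0); rewrite mul1r !mulg !divzK.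
rewrite /coefs /quad_form !form_simp /scale3 /=.
have gE n : (g %| n)%Z -> (n %/ g)%Z%:~R = n%:~R / g%:~R :> rat.
  by move=> /divzK {2}<-; rewrite rmorphM /= mulfK // intr_eq0.
by rewrite !gE // aE bE cE; congr (_, _, _); ring.
Qed.

(** A Bezout combination equal to 1 on the coefficients of f takes a value k on those of g, and
    proportionality gives g = k f over the integers. Then k divides the content 1 of g. *)
Lemma primitive_unique (f g : {mpoly int[2]}) :
  f \is 2.-homog -> g \is 2.-homog -> quad_primitive f -> quad_primitive g ->
  proportional (coefs f) (coefs g) -> eq_up_to_sign f g.
Proof.
have intrM_inj (a b x y : int) :
    a%:~R * x%:~R = b%:~R * y%:~R :> rat -> a * x = b * y.
  by rewrite -!intrM => /intr_inj.
move=> hf hg pf pg [/intrM_inj E0 /intrM_inj E1 /intrM_inj E2].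
move: pf pg; rewrite (quad_formE hf) (quad_formE hg) /quad_primitive.
move: E0 E1 E2.
move: (bcoef f 2 0) (bcoef f 1 1) (bcoef f 0 2) => a b c.
move: (bcoef g 2 0) (bcoef g 1 1) (bcoef g 0 2) => x y z E0 E1 E2.
rewrite /quad_form !form_simp => /eqP pf /eqP pg.
have [u [v uv]] := Bezoutz a b.
have [s [t st]] := Bezoutz (gcdz a b) c.
have bez : s * u * a + s * v * b + t * c = 1 by rewrite -pf -st -uv; ring.
pose k := s * u * x + s * v * y + t * z.
have xk : x = k * a.
  transitivity (s * u * a * x + s * v * (b * x) + t * (c * x)).
    by rewrite -[LHS]mul1r -bez; ring.
  by rewrite -E0 -E1 /k; ring.
have yk : y = k * b.
  transitivity (s * u * (a * y) + s * v * b * y + t * (c * y)).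
    by rewrite -[LHS]mul1r -bez; ring.
  by rewrite E0 -E2 /k; ring.
have zk : z = k * c.
  transitivity (s * u * (a * z) + s * v * (b * z) + t * c * z).
    by rewrite -[LHS]mul1r -bez; ring.
  by rewrite E1 E2 /k; ring.
have : (k %| gcdz (gcdz x y) z)%Z.
  by rewrite !dvdz_gcd xk yk zk !dvdz_mulr ?dvdzz.
rewrite pg dvdz1 => /eqP k1; have [ke|ke] : k = 1 \/ k = -1 by lia.
- by left; rewrite xk yk zk ke !mul1r.
- right; rewrite xk yk zk ke !mulN1r.
  by rewrite !mpolyCN; ring.
Qed.

(** * Signs of the discriminants *)

(** In signature (2, 1) no two negative vectors are orthogonal. Orthogonality says b y = 2 (a z + c
    x), whereas (b y)^2 < 16 a c x z <= 4 (a z + c x)^2. *)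
Lemma polar3_neq0 (K : realFieldType) (f g : K * K * K) :
  disc3 f < 0 -> disc3 g < 0 -> polar3 f g != 0.
Proof.
case: f g => [[a b] c] [[x y] z]; rewrite /disc3 /polar3 /=.
rewrite !subr_lt0 => hf hg; apply/eqP => /subr0_eq E.
have ac : 0 <= 4 * a * c := ltW (le_lt_trans (sqr_ge0 b) hf).
have : (b * y) ^+ 2 < 4 * a * c * (4 * x * z).
  rewrite exprMn; have [-> | y0] := eqVneq y 0.
    rewrite expr0n mulr0 mulr_gt0 ?(le_lt_trans (sqr_ge0 _) hf) //.
    exact: le_lt_trans (sqr_ge0 _) hg.
  apply: (@lt_le_trans _ _ (4 * a * c * y ^+ 2)).
    by rewrite ltr_pM2r // exprn_even_gt0.
  by rewrite ler_wpM2l // ltW.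
rewrite E; apply/negP; rewrite -leNgt.
have -> : (2 * (a * z + c * x)) ^+ 2
  = 4 * a * c * (4 * x * z) + 4 * (a * z - c * x) ^+ 2 by ring.
by rewrite lerDl mulr_ge0 ?ler0n ?sqr_ge0.
Qed.

(** Excludes three mutually orthogonal forms that all have positive discriminant. *)
Lemma disc3_orthogonal_prod (K : realFieldType) (f g h : K * K * K) :
  polar3 f g = 0 -> polar3 f h = 0 -> polar3 g h = 0 ->
  disc3 f * disc3 g * disc3 h <= 0.
Proof.
case: f g h => [[a b] c] [[x y] z] [[u v] w].
set p := polar3 _ _; set q := polar3 _ _; set r := polar3 _ _ => p0 q0 r0.
(* The Gram determinant of f, g, h is -4 times the square of their determinant. *)
pose D := a * (y * w - z * v) - b * (x * w - z * u) + c * (x * v - y * u).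
have -> : disc3 (a, b, c) * disc3 (x, y, z) * disc3 (u, v, w)
  = - (4 * D ^+ 2) + disc3 (a, b, c) * r ^+ 2 + disc3 (x, y, z) * q ^+ 2
    + disc3 (u, v, w) * p ^+ 2 - 2 * p * q * r.
  by rewrite /disc3 /p /q /r /polar3 /D /=; ring.
rewrite p0 q0 r0 !expr0n !mulr0 !addr0 subr0 oppr_le0.
by rewrite mulr_ge0 ?ler0n ?sqr_ge0.
Qed.

Lemma bval_quad (f : {mpoly int[2]}) (x y : int) : f \is 2.-homog ->
  bval f x y = bcoef f 2 0 * x ^+ 2 + bcoef f 1 1 * x * y + bcoef f 0 2 * y ^+ 2.
Proof.
move=> hf; rewrite {1}(quad_formE hf).
move: (bcoef f 2 0) (bcoef f 1 1) (bcoef f 0 2) => a b c.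
rewrite /bval /quad_form !mevalD !mevalM !mevalC !rmorphXn /= !mevalXU.
by rewrite !(tnth_nth 0) /=; ring.
Qed.

Lemma quad_disc_lt0_definite (f : {mpoly int[2]}) :
  f \is 2.-homog -> quad_disc f < 0 -> quad_definite f.
Proof.
move=> hf; rewrite /quad_disc /quad_definite; move: (fun x y => bval_quad x y hf).
move: (bcoef f 2 0) (bcoef f 1 1) (bcoef f 0 2) => a b c val D0.
have a0 : a != 0.
  by apply: contraTneq D0 => ->; rewrite mulr0 mul0r subr0 -leNgt sqr_ge0.
have pos x y : (x, y) != (0, 0) -> 0 < 4 * a * bval f x y.
  rewrite xpair_eqE val => xy.
  have -> : 4 * a * (a * x ^+ 2 + b * x * y + c * y ^+ 2)
    = (2 * a * x + b * y) ^+ 2 + (- (b ^+ 2 - 4 * a * c)) * y ^+ 2 by ring.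
  have [y0|y0] := eqVneq y 0.
    move: xy; rewrite y0 andbT => x0.
    by rewrite mulr0 addr0 expr0n mulr0 addr0 exprn_even_gt0 // !mulf_neq0.
  by rewrite ltr_wpDl ?sqr_ge0 // mulr_gt0 ?oppr_gt0 // exprn_even_gt0.
have [a_gt0|a_lt0|/eqP] := ltgtP 0 a; last by rewrite eq_sym (negPf a0).
- by left=> x y /pos; rewrite pmulr_rgt0 // mulr_gt0.
- by right=> x y /pos; rewrite nmulr_rgt0 // pmulr_rlt0.
Qed.

Lemma quad_disc_gt0_indefinite (f : {mpoly int[2]}) :
  f \is 2.-homog -> 0 < quad_disc f -> quad_indefinite f.
Proof.
move=> hf; rewrite /quad_disc /quad_indefinite; move: (fun x y => bval_quad x y hf).
move: (bcoef f 2 0) (bcoef f 1 1) (bcoef f 0 2) => a b c val D0.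
have opp x y x' y' : bval f x y * bval f x' y' < 0 ->
    (exists x y, 0 < bval f x y) /\ (exists x y, bval f x y < 0).
  have [v_gt0|v_lt0|<-] := ltgtP 0 (bval f x y); last by rewrite mul0r ltxx.
  - by rewrite pmulr_rlt0 // => v'; split; [exists x, y|exists x', y'].
  - by rewrite nmulr_rlt0 // => v'; split; [exists x', y'|exists x, y].
have [a0|a0] := eqVneq a 0; last first.
  (* f(1, 0) = a, and at (-b, 2 a), which is conjugate to (1, 0), the value is -a disc(f). The case
     c <> 0 below is symmetric. *)
  apply: (opp 1 0 (- b) (2 * a)); rewrite !val.
  have -> : (a * 1 ^+ 2 + b * 1 * 0 + c * 0 ^+ 2) *
    (a * (- b) ^+ 2 + b * - b * (2 * a) + c * (2 * a) ^+ 2)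
    = - (a ^+ 2 * (b ^+ 2 - 4 * a * c)) by ring.
  by rewrite oppr_lt0 mulr_gt0 // exprn_even_gt0.
have [c0|c0] := eqVneq c 0; last first.
  apply: (opp 0 1 (2 * c) (- b)); rewrite !val.
  have -> : (a * 0 ^+ 2 + b * 0 * 1 + c * 1 ^+ 2) *
    (a * (2 * c) ^+ 2 + b * (2 * c) * - b + c * (- b) ^+ 2)
    = - (c ^+ 2 * (b ^+ 2 - 4 * a * c)) by ring.
  by rewrite oppr_lt0 mulr_gt0 // exprn_even_gt0.
(* Only f = b x y remains. *)
apply: (opp 1 1 1 (-1)); rewrite !val a0 c0.
move: D0; rewrite a0 !(mulr0, mul0r) subr0 => b0.
by rewrite !(mul0r, add0r, addr0, mulr1, mulrN1) mulrN oppr_lt0 -expr2.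
Qed.

(** * Roots and discriminant of x^3 - 3 I x + J *)

(** The third root is -z - w, so the factors on the right are the differences of the roots. The
    discriminant of the cubic is 27 (4 I^3 - J^2), that is, 27^2 times the left-hand side. *)
Lemma cubic_two_roots (K : numFieldType) (I J z w : K) :
  z ^+ 3 - 3 * I * z + J = 0 -> w ^+ 3 - 3 * I * w + J = 0 -> z != w ->
  (4 * I ^+ 3 - J ^+ 2) / 27 = ((z - w) * (2 * z + w) * (z + 2 * w) / 27) ^+ 2.
Proof.
move=> rz rw; rewrite -subr_eq0 => zw.
have IE : I = (z ^+ 2 + z * w + w ^+ 2) / 3.
  apply/esym/subr0_eq/(mulfI zw); rewrite mulr0.
  transitivity ((z ^+ 3 - 3 * I * z + J - (w ^+ 3 - 3 * I * w + J)) / 3).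
    by field.
  by rewrite rz rw subrr mul0r.
have JE : J = 3 * I * z - z ^+ 3.
  by apply/eqP; rewrite -subr_eq0 -[X in _ == X]rz; apply/eqP; ring.
by rewrite JE IE; field.
Qed.

(** The discriminant 27^2 m^2 of the cubic is the discriminant of the quadratic cofactor of x - z
    times the square of the derivative 3 (z^2 - I) at z. The cofactor therefore has discriminant (9
    m / (z^2 - I))^2 and splits. *)
Lemma cubic_disc_sqr (K : numFieldType) (I J z m : K) :
  z ^+ 3 - 3 * I * z + J = 0 -> (4 * I ^+ 3 - J ^+ 2) / 27 = m ^+ 2 ->
  4 * I ^+ 3 != J ^+ 2 ->
  exists w1 w2, [/\ z != w1, z != w2, w1 != w2 &
    forall x, x ^+ 3 - 3 * I * x + J = (x - z) * (x - w1) * (x - w2)].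
Proof.
move=> rz Dm D0; have JE : J = 3 * I * z - z ^+ 3.
  by apply/eqP; rewrite -subr_eq0 -[X in _ == X]rz; apply/eqP; ring.
have q0 : z ^+ 2 - I != 0.
  by apply: contraNneq D0 => /subr0_eq E; rewrite JE -E; apply/eqP; ring.
have n27 : 27 != 0 :> K by rewrite pnatr_eq0.
have m0 : m != 0.
  apply: contraNneq D0 => m0; move: Dm; rewrite m0 expr0n /=.
  by move/eqP; rewrite mulf_eq0 invr_eq0 (negPf n27) orbF subr_eq0.
(* s^2 is the discriminant of the quadratic cofactor of x - z. *)
pose s := 9 * m / (z ^+ 2 - I).
have s2 : s ^+ 2 = 12 * I - 3 * z ^+ 2.
  by rewrite /s expr_div_n exprMn -Dm JE; field.
have s0 : s != 0 by rewrite !mulf_neq0 ?invr_eq0 // pnatr_eq0.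
have n2 : 2 != 0 :> K by rewrite pnatr_eq0.
have n12 : 12 != 0 :> K by rewrite pnatr_eq0.
(* The other roots are (s - z) / 2 and (-s - z) / 2; one of them equals z exactly when s = 3 z or s
   = -3 z. *)
have sz : s ^+ 2 != 9 * z ^+ 2.
  apply: contraNneq q0 => E; apply/eqP/(mulfI n12); rewrite mulr0.
  transitivity (9 * z ^+ 2 - (12 * I - 3 * z ^+ 2)); first by ring.
  by rewrite -s2 E subrr.
exists ((s - z) / 2), ((- s - z) / 2); split.
- apply: contraNneq sz => zs; apply/eqP.
  have -> : s = 2 * ((s - z) / 2) + z by field.
  by rewrite -zs; ring.
- apply: contraNneq sz => zs; apply/eqP.
  have -> : s = - (2 * ((- s - z) / 2) + z) by field.
  by rewrite -zs; ring.
- rewrite -subr_eq0; have -> : (s - z) / 2 - (- s - z) / 2 = s by field.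
  exact: s0.
- move=> x; transitivity ((x - z) * ((x + z / 2) ^+ 2 - s ^+ 2 / 4)).
    by rewrite s2 JE; field.
  by field.
Qed.

(** * Rational roots of the resolvent and fixing forms *)

Section Main.
Variable F : {mpoly int[2]}.
Hypothesis F_quartic : F \is 4.-homog.
Hypothesis F_disc : quartic_disc (toQ F) != 0.

Let Q := cubic_resolvent (toQ F).
Let D0 := quartic_disc_neq0 F_disc.

(** On the roots of the resolvent this relation is a bijection with the fixing forms up to sign, as
    the next four lemmas establish. *)
Definition associated (z : rat) (f : {mpoly int[2]}) :=
  fixing_form F f /\ eigen (toQ F) (- 2 * z) (coefs f).

Lemma root_associated z : root Q z -> exists f, associated z f.
Proof.
move=> /root_eigen [v v0 Ev]; have [f [k [hf pf fv]]] := primitive_scaling v0.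
have Ef : eigen (toQ F) (- 2 * z) (coefs f) by rewrite fv; exact: eigenZ.
by exists f; split=> //; apply/fixing_formP => //; split=> //; exists (- 2 * z).
Qed.

Lemma fixing_associated f : fixing_form F f -> exists2 z, root Q z & associated z f.
Proof.
move=> Ff; have /(fixing_formP _ F_quartic F_disc) [hf pf [mu Ef]] := Ff.
exists (- (mu / 2)); first by apply: eigen_root Ef; exact: primitive_neq0.
by split=> //; have -> : - 2 * - (mu / 2) = mu by field.
Qed.

Lemma associated_unique z f g :
  root Q z -> associated z f -> associated z g -> eq_up_to_sign f g.
Proof.
move=> rz [[hf pf _ _] Ef] [[hg pg _ _] Eg].
apply: (primitive_unique hf hg pf pg); apply: Classical_Prop.NNPP => nprop.
by move/eqP: D0; apply; exact: eigen_simple rz Ef Eg nprop.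
Qed.

Lemma associated_inj z w f g :
  associated z f -> associated w g -> eq_up_to_sign f g -> z = w.
Proof.
move=> [[_ pf _ _] Ef] [_ Eg] fg; have f0 := primitive_neq0 pf.
have n2 : -2 != 0 :> rat by [].
apply: (mulfI n2); apply: (eigen_unique f0 Ef).
case: fg => [-> //|fg].
have -> : coefs f = scale3 (-1) (coefs g); last exact: eigenZ.
by rewrite fg /coefs /scale3 /bcoef /= !mcoeffN !rmorphN !mulN1r.
Qed.

(** The roots give a rational square root of the discriminant; as the discriminant is an integer, so
    is that square root. *)
Lemma two_roots_disc z w : root Q z -> root Q w -> z != w ->
  exists m : int, quartic_disc (toQ F) = m%:~R ^+ 2.
Proof.
rewrite !root_resolventE => /eqP rz /eqP rw zw.
have DE := cubic_two_roots rz rw zw; have [D DD] := quartic_disc_toQ F.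
have [m rm] := sqr_intr (esym (etrans (esym DD) DE)).
by exists m; rewrite -rm.
Qed.

Lemma disc_sqr_roots z (m : int) :
  root Q z -> quartic_disc (toQ F) = m%:~R ^+ 2 ->
  exists w1 w2, [/\ z != w1, z != w2, w1 != w2 &
    [/\ root Q w1, root Q w2 &
      forall x, root Q x -> [\/ x = z, x = w1 | x = w2]]].
Proof.
rewrite root_resolventE => /eqP rz Dm.
have [w1 [w2 [zw1 zw2 w12 QE]]] := cubic_disc_sqr rz Dm D0.
exists w1, w2; split=> //; split; rewrite ?root_resolventE ?QE.
- by rewrite subrr mulr0 mul0r.
- by rewrite subrr mulr0.
- move=> x; rewrite root_resolventE QE !mulf_eq0 !subr_eq0 -orbA.
  by case/or3P => /eqP; [constructor 1|constructor 2|constructor 3].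
Qed.

Lemma associated_disc_neq0 z f : associated z f -> quad_disc f != 0.
Proof. by case=> -[]. Qed.

Lemma associated_orthogonal z w f g :
  z != w -> associated z f -> associated w g -> polar3 (coefs f) (coefs g) = 0.
Proof.
move=> zw [_ Ef] [_ Eg]; apply: eigen_orthogonal Ef Eg.
by apply: contraNneq zw => /(mulfI (isT : -2 != 0 :> rat)) ->.
Qed.

Lemma disc3_coefs_lt0 f : (disc3 (coefs f) < 0) = (quad_disc f < 0).
Proof. by rewrite disc3_coefs ltrz0. Qed.

Lemma associated_disc_gt0 z w f g :
  z != w -> associated z f -> associated w g -> quad_disc f < 0 ->
  0 < quad_disc g.
Proof.
move=> zw Af Ag Df; rewrite lt0r (associated_disc_neq0 Ag) /= leNgt.
apply/negP => Dg; have /eqP := associated_orthogonal zw Af Ag.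
by apply/negP; apply: polar3_neq0; rewrite disc3_coefs_lt0.
Qed.

Lemma associated_disc_lt0 z1 z2 z3 f1 f2 f3 :
  z1 != z2 -> z1 != z3 -> z2 != z3 ->
  associated z1 f1 -> associated z2 f2 -> associated z3 f3 ->
  [\/ quad_disc f1 < 0, quad_disc f2 < 0 | quad_disc f3 < 0].
Proof.
move=> z12 z13 z23 A1 A2 A3.
have := disc3_orthogonal_prod (associated_orthogonal z12 A1 A2)
  (associated_orthogonal z13 A1 A3) (associated_orthogonal z23 A2 A3).
rewrite !disc3_coefs -!intrM lerz0.
have [lt1|ge1] := ltP (quad_disc f1) 0; first by constructor 1.
have [lt2|ge2] := ltP (quad_disc f2) 0; first by constructor 2.
have [lt3|ge3] := ltP (quad_disc f3) 0; first by constructor 3.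
have pos z f : associated z f -> 0 <= quad_disc f -> 0 < quad_disc f.
  by move=> /associated_disc_neq0 f0; rewrite lt0r f0.
by rewrite leNgt !mulr_gt0 // ?(pos _ _ A1) ?(pos _ _ A2) ?(pos _ _ A3).
Qed.

(** Stated with the negative discriminant in first place; the other cases follow by permuting the
    roots. *)
Lemma three_fixing_forms z1 z2 z3 f1 f2 f3 :
  root Q z1 -> root Q z2 -> root Q z3 -> z1 != z2 -> z1 != z3 -> z2 != z3 ->
  (forall x, root Q x -> [\/ x = z1, x = z2 | x = z3]) ->
  associated z1 f1 -> associated z2 f2 -> associated z3 f3 ->
  quad_disc f1 < 0 ->
  exists f1 f2 f3 : {mpoly int[2]},
    [/\ [/\ fixing_form F f1, fixing_form F f2 & fixing_form F f3],
        [/\ ~ eq_up_to_sign f1 f2, ~ eq_up_to_sign f1 f3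
          & ~ eq_up_to_sign f2 f3],
        forall g : {mpoly int[2]}, fixing_form F g ->
          [\/ eq_up_to_sign g f1, eq_up_to_sign g f2
            | eq_up_to_sign g f3]
      & [/\ quad_definite f1, quad_indefinite f2
          & quad_indefinite f3]].
Proof.
move=> r1 r2 r3 z12 z13 z23 roots A1 A2 A3 D1; exists f1, f2, f3.
have neq z w f g : z != w -> associated z f -> associated w g ->
    ~ eq_up_to_sign f g.
  by move=> zw Af Ag /(associated_inj Af Ag) /eqP; apply/negP.
have [F1 _] := A1; have [F2 _] := A2; have [F3 _] := A3.
have [h1 _ _ _] := F1; have [h2 _ _ _] := F2; have [h3 _ _ _] := F3.
split.
- by split.
- by split; [apply: neq z12 _ _|apply: neq z13 _ _|apply: neq z23 _ _].
- move=> g /fixing_associated [x rx Ax].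
  case: (roots _ rx) => xE; rewrite xE in Ax.
  + by constructor 1; exact: associated_unique r1 Ax A1.
  + by constructor 2; exact: associated_unique r2 Ax A2.
  + by constructor 3; exact: associated_unique r3 Ax A3.
- split.
  + exact: quad_disc_lt0_definite.
  + exact: quad_disc_gt0_indefinite h2 (associated_disc_gt0 z12 A1 A2 D1).
  + exact: quad_disc_gt0_indefinite h3 (associated_disc_gt0 z13 A1 A3 D1).
Qed.

End Main.

Theorem theorem1p1 (F : {mpoly int[2]}) (F_quartic : F \is 4.-homog)
    (F_disc : quartic_disc (toQ F) != 0) :
  [/\ ~ irreducible_poly (cubic_resolvent (toQ F)) <->
        (exists T : 'M[rat]_2,
           [/\ T \in unitmx, ~~ is_scalar_mx T & twist (toQ F) T = toQ F]),
      ~ irreducible_poly (cubic_resolvent (toQ F)) <->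
        (exists f : {mpoly int[2]}, fixing_form F f)
    & ~ irreducible_poly (cubic_resolvent (toQ F)) ->
      (~ (exists m : int, quartic_disc (toQ F) = m%:~R ^+ 2) ->
         exists f : {mpoly int[2]},
           fixing_form F f /\
           forall g : {mpoly int[2]}, fixing_form F g -> eq_up_to_sign g f)
      /\
      ((exists m : int, quartic_disc (toQ F) = m%:~R ^+ 2) ->
         exists f1 f2 f3 : {mpoly int[2]},
           [/\ [/\ fixing_form F f1, fixing_form F f2 & fixing_form F f3],
               [/\ ~ eq_up_to_sign f1 f2, ~ eq_up_to_sign f1 f3
                 & ~ eq_up_to_sign f2 f3],
               forall g : {mpoly int[2]}, fixing_form F g ->
                 [\/ eq_up_to_sign g f1, eq_up_to_sign g f2
                   | eq_up_to_sign g f3]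
             & [/\ quad_definite f1, quad_indefinite f2
                 & quad_indefinite f3]])].
Proof.
have roots_forms : (exists z, root (cubic_resolvent (toQ F)) z) <->
    exists f, fixing_form F f.
  split=> [[z /(root_associated F_quartic F_disc) [f [Ff _]]]|[f]].
    by exists f.
  by move=> /(fixing_associated F_quartic F_disc) [z rz _]; exists z.
split; rewrite reducible_resolventP.
- split=> [/roots_forms [f Ff]|[T [unitT nscal tw]]].
    exists (quad_mx (toQ f)); have [_ _ Df tw] := Ff.
    by rewrite quad_mx_unit quad_mx_nonscalar.
  have FQ0 := quartic_disc_form_neq0 F_disc; have hFQ := homog_toQ F_quartic.
  move: tw; rewrite twist_quarticE // => tw.
  have [mu E] := transvectant_fixed unitT nscal hFQ tw.
  by exists (- (mu / 2)); exact: eigen_root (nonscalar_axis_neq0 nscal) E.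
- exact: roots_forms.
- move=> [z rz]; have [f Af] := root_associated F_quartic F_disc rz.
  split=> [nsq|[m Dm]].
    exists f; split=> [|g]; first by case: Af.
    move=> /(fixing_associated F_quartic F_disc) [w rw Ag].
    (* A second root would make the discriminant a square. *)
    have [zw|zw] := eqVneq z w; last by case: nsq; exact: two_roots_disc rz rw zw.
    by rewrite -zw in Ag; exact: (associated_unique F_disc rz Ag Af).
  have [z2 [z3 [z12 z13 z23 [r2 r3 roots]]]] := disc_sqr_roots F_disc rz Dm.
  have [f2 A2] := root_associated F_quartic F_disc r2.
  have [f3 A3] := root_associated F_quartic F_disc r3.
  (* Whichever form has negative discriminant is moved to the front. *)
  have [Dlt|Dlt|Dlt] := associated_disc_lt0 z12 z13 z23 Af A2 A3.
  + exact: three_fixing_forms roots Af A2 A3 Dlt.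
  + apply: (three_fixing_forms F_quartic F_disc r2 rz r3 _ z23 z13 _ A2 Af A3 Dlt).
      by rewrite eq_sym.
    by move=> x /roots [->|->|->]; [constructor 2|constructor 1|constructor 3].
  + apply: (three_fixing_forms F_quartic F_disc r3 rz r2 _ _ z12 _ A3 Af A2 Dlt);
      rewrite 1?eq_sym //.
    by move=> x /roots [->|->|->]; [constructor 2|constructor 3|constructor 1].
Qed.
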